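(* Let $X$ be a nonempty compact metrizable space and $\varphi:X\to X$ a continuous, locally injective surjection. Let $D=D_{\Gamma_\varphi}$ be the abelian $C^*$-algebra of bounded functions on $X$ associated with $\varphi$, let $\widehat D$ be its Gelfand spectrum, and let $\psi:\widehat D\to\widehat D$ be the map defined by $\psi(c)(g)=c(g\circ\varphi)$ for $c\in\widehat D$, $g\in D$. Then $\psi$ is a surjective local homeomorphism.
   Context: $\mathbb N=\{0,1,2,\dots\}$. Locally injective means that the topology of $X$ has a basis consisting of sets on which $\varphi$ is injective. Groupoid: $\Gamma_\varphi=\{(x,k,y)\in X\times\mathbb Z\times X:\exists a,b\in\mathbb N,\ k=a-b,\ \varphi^a(x)=\varphi^b(y)\}$, with product $(x,k,y)(y,k',y')=(x,k+k',y')$ and inverse $(x,k,y)^{-1}=(y,-k,x)$. For $k\in\mathbb Z$ and $n\in\mathbb N$ with $n+k\ge 0$ let $\Gamma_\varphi(k,n)=\{(x,l,y)\in X\times\mathbb Z\times X: l=k,\ \varphi^{k+i}(x)=\varphi^i(y)\ \text{for all } i\ge n\}$ with the relative topology from $X\times\mathbb Z\times X$; $\Gamma_\varphi(k,n)$ is open in $\Gamma_\varphi(k,n+1)$. $\Gamma_\varphi(k)=\bigcup_{n}\Gamma_\varphi(k,n)$ has the inductive limit topology, and $\Gamma_\varphi=\bigsqcup_k\Gamma_\varphi(k)$ has the topology in which each $\Gamma_\varphi(k)$ is open and closed. This is a locally compact Hausdorff groupoid with unit space identified with $X$ via $x\mapsto(x,0,x)$. Algebras: $\mathrm{alg}^*\Gamma_\varphi$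 is the $*$-algebra of functions on $\Gamma_\varphi$ generated by the continuous compactly supported functions under the convolution $f\star g(x,k,y)=\sum_{z,\,n+m=k}f(x,n,z)g(z,m,y)$ and the involution $f^*(x,k,y)=\overline{f(y,-k,x)}$; its elements are bounded with compact support but not necessarily continuous. $C^*_r(\Gamma_\varphi)$ is its completion in the reduced norm $\|f\|=\sup_{x\in X}\|\pi_x(f)\|$, where $\pi_x$ is the representation on $\ell^2(\{(z,k,y)\in\Gamma_\varphi:y=x\})$ given by $(\pi_x(f)\xi)(\gamma)=\sum_{\gamma_1\gamma_2=\gamma}f(\gamma_1)\xi(\gamma_2)$. $D_{\Gamma_\varphi}$ is the closure in $C^*_r(\Gamma_\varphi)$ of the set of elements of $\mathrm{alg}^*\Gamma_\varphi$ supported in the unit space; it is a separable abelian $C^*$-algebra of bounded functions on $X$ (pointwise operations, supremum norm) containing $C(X)$. One has $g\circ\varphi\in D_{\Gamma_\varphi}$ for all $g\in D_{\Gamma_\varphi}$. $\widehat D$ is the set of unital $*$-homomorphisms $c:D\to\mathbb C$ with the weak* topology, a compact metrizable space. *)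

(* Defs.v *)
From HB Require Import structures.
From mathcomp Require Import all_boot all_order all_algebra.
From mathcomp Require Import all_classical all_reals all_analysis.
From mathcomp Require Import complex.
Set Implicit Arguments.
Unset Strict Implicit.
Unset Printing Implicit Defensive.
Import Order.TTheory GRing.Theory Num.Theory.
Import numFieldNormedType.Exports.
Local Open Scope classical_set_scope.
Local Open Scope ring_scope.

(* [R[i]] is the field of complex numbers over [R : realType]; its topology is
   the norm topology, which the library attaches to the alias [R[i]^o]. *)

Section general_topology.

Definition metrizable (R : realType) (X : topologicalType) : Prop :=
  exists d : X -> X -> R,
    [/\ forall x y, 0 <= d x y,
        forall x y, d x y = 0 <-> x = y,
        forall x y, d x y = d y x,
        forall x y z, d x z <= d x y + d y z &
        forall x, nbhs x = filter_from [set e : R | 0 < e]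
                             (fun e => [set y | d x y < e])].

Definition locally_injective (X : topologicalType) (Y : Type) (f : X -> Y)
    : Prop :=
  exists2 B : set (set X), basis B & forall U, B U -> {in U &, injective f}.

Definition local_homeomorphism (T U : topologicalType) (f : T -> U) : Prop :=
  forall x : T, exists A : set T,
    [/\ open A, A x, open (f @` A), {within A, continuous f} &
        exists g : U -> T,
          {in A, cancel f g} /\ {within f @` A, continuous g}].

End general_topology.

Section groupoid.
Context {X : topologicalType}.
Implicit Type phi : X -> X.

Definition in_groupoid phi (g : X * int * X) : Prop :=
  exists a b : nat, g.1.2 = a%:Z - b%:Z /\ iter a phi g.1.1 = iter b phi g.2.

Record groupoid phi := Groupoid {
  gval :> X * int * X ;
  gvalP : in_groupoid phi gval }.

HB.instance Definition _ phi := gen_eqMixin (groupoid phi).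
HB.instance Definition _ phi := gen_choiceMixin (groupoid phi).

Definition grange phi (g : groupoid phi) : X := g.1.1.
Definition gdeg phi (g : groupoid phi) : int := g.1.2.
Definition gsource phi (g : groupoid phi) : X := g.2.

Definition gunit phi (x : X) : groupoid phi :=
  @Groupoid phi (x, 0, x) (ex_intro _ 0%N (ex_intro _ 0%N (conj erefl erefl))).

Lemma in_groupoid_inv phi (g : groupoid phi) :
  in_groupoid phi (gsource g, - gdeg g, grange g).
Proof.
have [a [b [kab ab]]] := gvalP g.
by exists b, a; split; [rewrite /= /gdeg kab opprB|exact: esym].
Qed.

Definition ginv phi (g : groupoid phi) : groupoid phi :=
  Groupoid (in_groupoid_inv g).

Definition is_gmul phi (g1 g2 g : groupoid phi) : Prop :=
  [/\ gsource g1 = grange g2, grange g = grange g1,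
      gdeg g = gdeg g1 + gdeg g2 & gsource g = gsource g2].

(* For [0 <= n + k] and [n <= i] the integer [k + i] is nonnegative, so [absz]
   only converts it to [nat]. *)
Definition groupoid_layer phi (k : int) (n : nat) : set (groupoid phi) :=
  [set g | gdeg g = k /\ forall i : nat, (n <= i)%N ->
     iter `|(k + i%:Z)%R|%N phi (grange g) = iter i phi (gsource g)].

(* Each [groupoid_layer k n] carries the relative topology of X x Z x X; the
   open sets of the disjoint union of their inductive limits are those whose
   trace on every layer is relatively open. *)
Definition groupoid_open phi (U : set (groupoid phi)) : Prop :=
  forall (k : int) (n : nat), 0 <= n%:Z + k ->
    exists2 V : set (X * discrete_topology int * X), open V &
      U `&` @groupoid_layer phi k n
        = (@gval phi @^-1` V) `&` @groupoid_layer phi k n.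

Lemma groupoid_openT phi : groupoid_open [set: groupoid phi].
Proof. by move=> k n _; exists setT; [exact: openT|rewrite preimage_setT]. Qed.

Lemma groupoid_openI phi : setI_closed (@groupoid_open phi).
Proof.
move=> A B oA oB k n kn; have [V oV VA] := oA k n kn; have [W oW WB] := oB k n kn.
exists (V `&` W); first exact: openI.
by rewrite setIIl VA WB -setIIl preimage_setI.
Qed.

Lemma groupoid_open_bigcup phi (I : Type) (f : I -> set (groupoid phi)) :
  (forall i, groupoid_open (f i)) -> groupoid_open (\bigcup_i f i).
Proof.
move=> of_ k n kn.
have /choice[V VP] : forall i, exists V : set (X * discrete_topology int * X),
    open V /\ f i `&` @groupoid_layer phi k n
              = (@gval phi @^-1` V) `&` @groupoid_layer phi k n.
  by move=> i; have [V oV VE] := of_ i k n kn; exists V.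
exists (\bigcup_i V i); first by apply: bigcup_open => i _; have [] := VP i.
rewrite preimage_bigcup !setI_bigcupl; apply: eq_bigcupr => i _.
by have [_ ->] := VP i.
Qed.

HB.instance Definition _ phi := isOpenTopological.Build (groupoid phi)
  (@groupoid_openT phi) (@groupoid_openI phi) (@groupoid_open_bigcup phi).

End groupoid.

Section algebras.
Context {R : realType} {X : topologicalType}.
Context {phi : X -> X}.
Implicit Types f h xi : groupoid phi -> R[i].

Definition Cc_groupoid : set (groupoid phi -> R[i]) :=
  [set f | continuous (f : groupoid phi -> R[i]^o) /\
           compact (closure [set g | f g != 0])].

(* [\sum_(p \in A)] is a finitely supported sum, equal to 0 when infinitely
   many terms are nonzero; this does not occur for compactly supported [f], as
   the fibres of the range map are discrete. *)
Definition conv f h : groupoid phi -> R[i] := fun g =>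
  \sum_(p \in [set p : groupoid phi * groupoid phi | is_gmul p.1 p.2 g])
     f p.1 * h p.2.

Definition star f : groupoid phi -> R[i] := fun g => (f (ginv g))^*%C.

Definition star_algebra_closed (A : set (groupoid phi -> R[i])) : Prop :=
  [/\ forall f h, A f -> A h -> A (fun g => f g + h g),
      forall (a : R[i]) f, A f -> A (fun g => a * f g),
      forall f h, A f -> A h -> A (conv f h) &
      forall f, A f -> A (star f)].

Definition alg_star : set (groupoid phi -> R[i]) :=
  smallest star_algebra_closed Cc_groupoid.

(* Vectors of the l2 space of the fibre over [x] are functions on the whole
   groupoid; their values off that fibre play no role. *)
Definition source_fibre (x : X) : set (groupoid phi) :=
  [set g | gsource g = x].

Definition l2norm (x : X) xi : \bar R :=
  sqrte (\esum_(g in source_fibre x) ((Normc.normc (xi g)) ^+ 2)%:E).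

Definition regular_rep f xi : groupoid phi -> R[i] := fun g =>
  \sum_(p \in [set p : groupoid phi * groupoid phi | is_gmul p.1 p.2 g])
     f p.1 * xi p.2.

Definition regular_rep_norm (x : X) f : \bar R :=
  ereal_sup [set l2norm x (regular_rep f xi) |
             xi in [set xi | (l2norm x xi <= 1)%E]].

Definition reduced_norm f : \bar R :=
  ereal_sup [set regular_rep_norm x f | x in [set: X]].

(* Points of the completion of [alg_star] are represented by Cauchy sequences
   for the reduced norm. *)
Definition Cstar_r_point (u : nat -> groupoid phi -> R[i]) : Prop :=
  (forall n, alg_star (u n)) /\
  forall e : R, 0 < e -> exists N : nat, forall m n, (N <= m)%N -> (N <= n)%N ->
    (reduced_norm (fun g => (u m g - u n g)%R) < e%:E)%E.

(* The point represented by [u] is in the closure of the image of [S]. *)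
Definition Cstar_r_closure (S : set (groupoid phi -> R[i]))
    (u : nat -> groupoid phi -> R[i]) : Prop :=
  Cstar_r_point u /\
  forall e : R, 0 < e -> exists2 f, S f & exists N : nat,
    forall n, (N <= n)%N -> (reduced_norm (fun g => (u n g - f g)%R) < e%:E)%E.

Definition unit_supported : set (groupoid phi -> R[i]) :=
  [set f | alg_star f /\ forall g, f g != 0 -> exists x, g = gunit phi x].

(* A point of the closure is identified with the function on X that extends
   the restriction [x |-> f (x, 0, x)] by continuity. *)
Definition D_groupoid : set (X -> R[i]) :=
  [set a | exists2 u, Cstar_r_closure unit_supported u &
     forall x, (fun n => (u n (gunit phi x) : R[i]^o)) @ \oo --> (a x : R[i]^o)].

(* Sums, products, etc. of elements of [D_groupoid] are handled through an
   element [s] of it with the prescribed values. *)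
Definition character (c : D_groupoid -> R[i]) : Prop :=
  [/\ forall a b s : D_groupoid,
        \val s = (fun x => \val a x + \val b x) -> c s = c a + c b,
      forall (l : R[i]) (a s : D_groupoid),
        \val s = (fun x => l * \val a x) -> c s = l * c a,
      forall a b s : D_groupoid,
        \val s = (fun x => \val a x * \val b x) -> c s = c a * c b,
      forall a s : D_groupoid,
        \val s = (fun x => (\val a x)^*%C) -> c s = (c a)^*%C &
      forall s : D_groupoid, \val s = (fun=> 1) -> c s = 1].

(* The topology of this subtype is the relative topology of pointwise
   convergence, i.e., the weak* topology. *)
Definition spectrum : set {ptws D_groupoid -> R[i]^o} := [set c | character c].

Definition is_dual_map (psi : spectrum -> spectrum) : Prop :=
  forall (c : spectrum) (a : D_groupoid),
    exists2 b : D_groupoid, \val b = \val a \o phi & \val (psi c) a = \val c b.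

Lemma is_dual_map_unique (psi1 psi2 : spectrum -> spectrum) :
  is_dual_map psi1 -> is_dual_map psi2 -> psi1 = psi2.
Proof.
move=> h1 h2; apply/funext => c; apply/val_inj/funext => a.
have [b1 e1 ->] := h1 c a; have [b2 e2 ->] := h2 c a.
by congr (\val c _); apply/val_inj; rewrite e1 e2.
Qed.

End algebras.

(* Main.v *)
(* The functions on the groupoid supported on [{(x, 1, phi x)}] implement on
   [D] both composition with [phi] and the transfer operator
   [L h y = \sum_(phi x = y) h x].  Take a partition of unity [p_i] by continuous
   functions, [phi] being injective on the support of each [p_i].  Then
     [p_i (L (p_i a) \o phi) = p_i^2 a],  [L (p_i (b \o phi)) = L (p_i) b]
   and [L (p_i a) L (p_i b) = L (p_i) L (p_i a b)].  Hence [psi] maps the open set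
   [c (p_i) != 0] bijectively onto the open set [d (L p_i) != 0], with inverse
   [d |-> (a |-> d (L (p_i a)) / d (L p_i))].  The first sets cover the spectrum
   because the [p_i] add up to 1.  So do the second ones: [L 1 = \sum_i L p_i]
   counts preimages, hence takes finitely many values, all of them positive
   integers, and no character can vanish on it. *)

From HB Require Import structures.
Require Import Defs.
From mathcomp Require Import all_boot all_order all_algebra finmap.
From mathcomp Require Import all_classical all_reals all_analysis.
From mathcomp Require Import complex lra.
Set Implicit Arguments.
Unset Strict Implicit.
Unset Printing Implicit Defensive.
Import Order.TTheory GRing.Theory Num.Theory.
Import numFieldNormedType.Exports.
Local Open Scope classical_set_scope.
Local Open Scope ring_scope.
Local Open Scope complex_scope.
Local Notation normc := Normc.normc.

(** * Functions on the graphs of the iterates *)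

Lemma fsbig_single (V : nmodType) (T : choiceType) (A : set T) (t : T)
    (F : T -> V) : A t ->
  (forall s, A s -> F s != 0 -> s = t) -> \sum_(s \in A) F s = F t.
Proof.
move=> At Ft; rewrite -[RHS](@fsbig_set1 V 0 +%R T t F); apply/esym/fsbig_widen.
  by move=> _ ->.
move=> s [As /= st]; apply/eqP; case: eqVneq => // /eqP/eqP Fs0.
by case: st; exact: Ft.
Qed.

Section groupoid_elements.
Context {X : topologicalType} {phi : X -> X}.
Implicit Types g : groupoid phi.

Lemma groupoid_ext g1 g2 : grange g1 = grange g2 -> gdeg g1 = gdeg g2 ->
  gsource g1 = gsource g2 -> g1 = g2.
Proof.
case: g1 g2 => -[[x1 k1] y1] p1 [[[x2 k2] y2] p2].
rewrite /grange /gdeg /gsource /= => e1 e2 e3; subst x2 k2 y2.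
by congr Groupoid; exact: Prop_irrelevance.
Qed.

Lemma in_groupoid_graph k x : in_groupoid phi (x, k%:Z, iter k phi x).
Proof. by exists k, 0%N; rewrite subr0. Qed.

Definition graph_elt k x : groupoid phi := Groupoid (in_groupoid_graph k x).

(** If [phi^a x = phi^b y], then [phi^a (phi^k x) = phi^(b + k) y]; this triple is what remains of
    [g] once the arrow from [x] to [phi^k x] is split off on the left. *)
Lemma in_groupoid_tail k g :
  in_groupoid phi (iter k phi (grange g), gdeg g - k%:Z, gsource g).
Proof.
have [a [b [/= gab ab]]] := gvalP g; exists a, (b + k)%N; split => /=.
  by rewrite /gdeg gab PoszD opprD addrA.
rewrite -iterD addnC [(b + k)%N]addnC !iterD.
by rewrite /grange ab /gsource.
Qed.

Definition tail_elt k g : groupoid phi := Groupoid (in_groupoid_tail k g).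

Lemma tail_elt0 g : tail_elt 0 g = g.
Proof. by apply: groupoid_ext => //; rewrite /gdeg /= subr0. Qed.

Lemma gunitE x : gunit phi x = graph_elt 0 x.
Proof. exact: groupoid_ext. Qed.

Definition on_graph k g : Prop :=
  gdeg g = k%:Z /\ gsource g = iter k phi (grange g).

Lemma on_graphE k g : on_graph k g -> g = graph_elt k (grange g).
Proof. by case=> dg sg; apply: groupoid_ext. Qed.

Lemma is_gmul_graph k g : is_gmul (graph_elt k (grange g)) (tail_elt k g) g.
Proof. by split => //; rewrite /gdeg /= addrCA subrr addr0. Qed.

(** A first factor on the graph is fixed by its range, which is that of [g]; cancellation then fixes
    the second. Convolution by a function carried by the graph thus has a single term. *)
Lemma is_gmul_graphP k g g1 g2 : on_graph k g1 -> is_gmul g1 g2 g ->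
  (g1, g2) = (graph_elt k (grange g), tail_elt k g).
Proof.
move=> [d1 s1] [s1r2 rg dg sg]; congr pair; apply: groupoid_ext.
- exact/esym.
- exact: d1.
- by rewrite s1 -rg.
- by rewrite -s1r2 s1 -rg.
- by transitivity (gdeg g - k%:Z) => //; rewrite dg d1 addrC addKr.
- exact/esym.
Qed.

End groupoid_elements.

Section glifts.
Context {R : realType} {X : topologicalType} {phi : X -> X}.
Implicit Types (g : groupoid phi) (a b : X -> R[i]) (f h : groupoid phi -> R[i]).

(** For [k = 0] this places functions on [X] on the unit space; for [k = 1] it gives the functions
    carried by the triples [(x, 1, phi x)]. *)
Definition glift k a g : R[i] := if `[< on_graph k g >] then a (grange g) else 0.

Lemma gliftT k a g : on_graph k g -> glift k a g = a (grange g).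
Proof. by move=> kg; rewrite /glift asboolT. Qed.

Lemma gliftF k a g : ~ on_graph k g -> glift k a g = 0.
Proof. by move=> kg; rewrite /glift asboolF. Qed.

Lemma glift_neq0 k a g : glift k a g != 0 -> on_graph k g.
Proof. by rewrite /glift; case: asboolP => //; rewrite eqxx. Qed.

Lemma glift_gunit a x : glift 0 a (gunit phi x) = a x.
Proof. by rewrite gliftT. Qed.

Lemma gliftD k a b : glift k (fun x => a x + b x) = (fun g => glift k a g + glift k b g).
Proof. by apply/funext => g; rewrite /glift; case: ifP => // _; rewrite addr0. Qed.

Lemma gliftZ k (l : R[i]) a : glift k (fun x => l * a x) = (fun g => l * glift k a g).
Proof. by apply/funext => g; rewrite /glift; case: ifP => // _; rewrite mulr0. Qed.

Lemma gliftB k a b : glift k (fun x => a x - b x) = (fun g => glift k a g - glift k b g).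
Proof. by apply/funext => g; rewrite /glift; case: ifP => // _; rewrite subr0. Qed.

Lemma conv_glift k a h :
  Defs.conv (glift k a) h = (fun g => a (grange g) * h (tail_elt k g)).
Proof.
apply/funext => g; rewrite /Defs.conv.
rewrite (fsbig_single (t := (graph_elt k (grange g), tail_elt k g))) /=.
- by rewrite gliftT.
- exact: is_gmul_graph.
- move=> [g1 g2] /= g12; rewrite mulf_eq0 => /norP[/glift_neq0 kg1 _].
  exact: is_gmul_graphP g12.
Qed.

(** The regular representation is given by the convolution formula, so a function on the unit space
    acts as a multiplication operator. *)
Lemma regular_rep_glift0 a f :
  regular_rep (glift 0 a) f = (fun g => a (grange g) * f g).
Proof.
have -> : regular_rep (glift 0 a) f = Defs.conv (glift 0 a) f by [].
by rewrite conv_glift; apply/funext => g; rewrite tail_elt0.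
Qed.

Lemma conv_glift0 k a b :
  Defs.conv (glift 0 a) (glift k b) = glift k (fun x => a x * b x).
Proof.
rewrite conv_glift; apply/funext => g; rewrite tail_elt0 /glift.
by case: ifP => // _; rewrite mulr0.
Qed.

Lemma star_glift0 a : star (glift 0 a) = glift 0 (fun x => (a x)^*%C) :> (groupoid phi -> _).
Proof.
apply/funext => g; rewrite /star.
have [g0|g0] := pselect (on_graph 0 g).
  have := on_graphE g0; set x := grange g => ->.
  by rewrite !gliftT.
rewrite !gliftF ?conjc0// => -[dg sg]; apply: g0; split; last exact/esym.
by move/eqP: dg; rewrite /gdeg /= oppr_eq0 => /eqP.
Qed.

(* The product lives on the triples [(x, 0, y)] with [phi x = phi y]; the
   hypothesis leaves only the diagonal ones. *)
Lemma conv_glift1_sandwich a b c :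
  (forall x y, phi x = phi y -> b x != 0 -> c y != 0 -> x = y) ->
  Defs.conv (glift 1 b) (Defs.conv (glift 0 a) (star (glift 1 c))) =
  glift 0 (fun x => b x * (c x)^*%C * a (phi x)) :> (groupoid phi -> _).
Proof.
move=> bc; rewrite !conv_glift; apply/funext => g /=.
rewrite tail_elt0 /= {2}/grange /= /star.
have [g0|g0] := pselect (on_graph 0 g).
  have [d0 s0] := g0; rewrite [RHS]gliftT// gliftT.
    have -> : grange (ginv (tail_elt 1 g)) = grange g by exact: s0.
    by rewrite mulrCA mulrC.
  split; last by have /esym/(congr1 phi) := s0.
  by transitivity (- (gdeg g - 1)) => //; rewrite d0 sub0r opprK.
rewrite [RHS]gliftF//.
have [g1|g1] := pselect (on_graph 1 (ginv (tail_elt 1 g))); last first.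
  by rewrite (gliftF _ g1) conjc0 !mulr0.
rewrite gliftT// /=; apply/eqP; apply: contra_notT g0.
rewrite !mulf_eq0 !negb_or conjc_eq0 => /and3P[b0 _ c0].
(* Here [s1] amounts to [phi (grange g) = phi (gsource g)], and [bc] then makes [g] a unit, contrary
   to [g0]. *)
case: g1 => d1 s1; have {}d1 : - (gdeg g - 1) = 1 by exact: d1.
split; last exact/esym/bc.
by apply/oppr_inj/(addrI 1); rewrite -opprB d1 subr0.
Qed.

(** The Ruelle transfer operator of [phi] with constant weight 1. *)
Definition transfer (a : X -> R[i]) (y : X) : R[i] :=
  \sum_(x \in phi @^-1` [set y]) a x.

(** A nonzero term comes from a factorization of [g] as the inverse of [(x, 1, phi x)] times
    [(x, 1, phi x)]. Hence [g] is the unit at [phi x], and the terms are indexed by the preimages of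
    its range. *)
Lemma conv_star_glift1 a b :
  Defs.conv (star (glift 1 b)) (glift 1 a) =
  glift 0 (transfer (fun x => (b x)^*%C * a x)) :> (groupoid phi -> _).
Proof.
apply/funext => g; rewrite /Defs.conv.
pose S p := star (glift 1 b) p.1 * glift 1 a p.2.
have nz p : is_gmul p.1 p.2 g -> S p != 0 -> exists x, [/\
    p = (ginv (graph_elt 1 x), graph_elt 1 x), on_graph 0 g & phi x = grange g].
  case: p => p1 p2 /= [s1r2 rg dg sg].
  rewrite mulf_eq0 conjc_eq0 => /norP[/glift_neq0[d1 s1] /glift_neq0[d2 s2]].
  exists (grange p2); split.
  - congr pair; apply: groupoid_ext => //=.
    + by rewrite [LHS]s1 -s1r2.
    + by move: d1; rewrite /gdeg /= => /(congr1 -%R); rewrite opprK.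
  - split; last by rewrite sg rg s2 /= [RHS]s1 -s1r2.
    by rewrite dg d2; move: d1; rewrite /gdeg /= => <-; rewrite subrr.
  - by rewrite rg [RHS]s1 -s1r2.
have [g0|g0] := pselect (on_graph 0 g); last first.
  rewrite gliftF//; apply: fsbig1 => p gp; apply/eqP.
  by apply: contra_notT g0 => /(nz _ gp)[x []].
rewrite gliftT//; rewrite /transfer.
have [d0 s0] := g0.
pose e x : groupoid phi * groupoid phi := (ginv (graph_elt 1 x), graph_elt 1 x).
transitivity (\sum_(p \in e @` (phi @^-1` [set grange g])) S p).
  apply/esym/fsbig_widen.
    move=> _ [x /= gx <-]; split => //.
    by rewrite s0 /= -gx.
  move=> p [/nz gp ep]; apply/eqP; apply: contra_notT ep => /gp[x [-> _ gx]].
  by exists x.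
rewrite fsbig_image; last by move=> x y _ _ [].
apply: eq_fsbigr => x _; rewrite /S /= /star gliftT; last first.
  by split => //; rewrite /gdeg /= opprK.
by rewrite gliftT.
Qed.

End glifts.

Arguments transfer {R X} phi a y.

(** * The topology of the groupoid *)

Lemma open_neq_continuous (T U : topologicalType) (f h : T -> U) : hausdorff_space U ->
  continuous f -> continuous h -> open [set z | f z <> h z].
Proof.
rewrite open_hausdorff => hU cf ch; rewrite openE => z /= /eqP fhz.
have [[A B] /= [/set_mem Az /set_mem Bz] [oA oB /eqP AB]] := hU _ _ fhz.
have nA : nbhs z (f @^-1` A) by apply: cf; exact: open_nbhs_nbhs.
have nB : nbhs z (h @^-1` B) by apply: ch; exact: open_nbhs_nbhs.
apply: filterS2 nA nB => t /= At Bt E.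
by have : set0 (f t) by rewrite -AB; split => //; rewrite E.
Qed.

Lemma continuous_pair (T U V : topologicalType) (f : T -> U) (h : T -> V) :
  continuous f -> continuous h -> continuous (fun z => (f z, h z)).
Proof. by move=> cf ch z; apply: cvg_pair; [exact: cf|exact: ch]. Qed.

Lemma continuous_iter (T : topologicalType) (f : T -> T) k :
  continuous f -> continuous (iter k f).
Proof.
move=> cf; elim: k => [|k IH] x; first exact: cvg_id.
exact: (continuous_comp (IH x) (cf _)).
Qed.

Lemma metrizable_hausdorff (R : realType) (X : topologicalType) :
  metrizable R X -> hausdorff_space X.
Proof.
case=> d [d0 dE dC dT nb] x y xy; apply/dE/eqP; apply/negPn/negP => dxy.
have r0 : 0 < d x y / 2 by rewrite divr_gt0// lt_neqAle eq_sym dxy d0.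
have bx z : nbhs z [set t | d z t < d x y / 2] by rewrite nb; exists (d x y / 2).
have [t [/= xt yt]] := xy _ _ (bx x) (bx y).
have := dT x t y; rewrite leNgt => /negP; apply.
by rewrite [ltRHS](splitr (d x y)) ltrD// dC.
Qed.

Section groupoid_topology.
Context {R : realType} {X : topologicalType} {phi : X -> X}.
Context (X_compact : compact [set: X]).
Context (X_hausdorff : hausdorff_space X).
Context (phi_continuous : continuous phi).
Context (phi_locally_injective : locally_injective phi).
Local Notation ambient := (X * discrete_topology int * X)%type.
Implicit Types (U : set (groupoid phi)) (V : set ambient).

Lemma layer_le k m n : (m <= n)%N ->
  @groupoid_layer X phi k m `<=` @groupoid_layer X phi k n.
Proof. by move=> mn g [kg gm]; split => // i /(leq_trans mn); exact: gm. Qed.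

Lemma open_groupoidE U : open U = groupoid_open U.
Proof. by []. Qed.

Lemma open_preimage_gval V : open V -> open (@gval _ phi @^-1` V).
Proof. by move=> oV; rewrite open_groupoidE => k n _; exists V. Qed.

Lemma continuous_grange : continuous (@grange X phi).
Proof.
apply/continuousP => A oA.
apply: (@open_preimage_gval [set p : ambient | A p.1.1]).
apply: (@open_comp _ _ (fun p : ambient => p.1.1)) => // p _.
by apply: continuous_comp; exact: cvg_fst.
Qed.

(** The whole graph lies in the layer of degree [k] and index 0, so only the trace of an open set on
    that layer matters, and there the topology is that of the product. *)
Lemma continuous_graph_elt k : continuous (@graph_elt X phi k).
Proof.
apply/continuousP => A; rewrite open_groupoidE => /(_ k%:Z 0%N isT)[V oV AV].
have -> : graph_elt k @^-1` A = (fun x => (x, k%:Z, iter k phi x)) @^-1` V.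
  apply/seteqP; rewrite predeqE in AV.
  have lk x : @groupoid_layer X phi k 0 (graph_elt k x).
    by split => // i _; rewrite -PoszD absz_nat /= -!iterD addnC.
  split=> x /=; first by move=> Ax; have [] := (AV (graph_elt k x)).1 (conj Ax (lk x)).
  by move=> Vx; have [] := (AV (graph_elt k x)).2 (conj Vx (lk x)).
apply: (@open_comp _ ambient (fun x => (x, k%:Z, iter k phi x))) => // x _.
apply: (@continuous_pair _ _ _ (fun x => (x, k%:Z : discrete_topology int))).
  by apply: continuous_pair => z; [exact: cvg_id|exact: cvg_cst].
exact: continuous_iter.
Qed.

(** The union of the squares [U * U], over the basic sets [U] on which [phi] is injective, is a
    neighbourhood of the diagonal that meets the relation [phi x = phi y] only in the diagonal. *)
Lemma diagonal_injectivity_nbhd : exists2 W : set (X * X), open W &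
  (forall x, W (x, x)) /\ forall x y, W (x, y) -> phi x = phi y -> x = y.
Proof.
have [B [oB nB] inj] := phi_locally_injective.
exists (\bigcup_(U in B) [set p | U p.1 /\ U p.2]).
  apply: bigcup_open => U BU; rewrite openE => -[x y] [/= Ux Uy].
  by exists (U, U) => //; split; apply: open_nbhs_nbhs; split => //; exact: oB.
split=> [x|x y [U BU [/= Ux Uy]]]; last by apply: (inj _ BU); exact: mem_set.
have [U [BU Ux] _] := nB x setT (@filterT _ (nbhs x) _).
by exists U.
Qed.

(** Induction on the index of the layer. In degree [k], layer 0 is contained in the graph; an
    element of layer [n + 1] falls back into layer [n] as soon as its points [phi^(k + n) x] and
    [phi^n y], which have the same image under [phi], are close in the sense of [W]. *)
Lemma open_on_graph k : open (@on_graph X phi k).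
Proof.
have [W oW [Wxx Winj]] := diagonal_injectivity_nbhd.
rewrite open_groupoidE => l n _; have [->|lk] := eqVneq l k%:Z; last first.
  exists set0; first exact: open0.
  apply/seteqP; split=> g [] // [dg _] [lg _].
  by move: lk; rewrite -lg dg eqxx.
elim: n => [|n [V oV VE]].
  exists setT; first exact: openT.
  apply/seteqP; split=> g [] // _ [dg g0]; split => //; split => //.
  by have := g0 0%N (leqnn _); rewrite addr0 /= => ->.
pose Wn : set ambient := [set p | W (iter (k + n) phi p.1.1, iter n phi p.2)].
exists (V `&` Wn).
  apply: openI => //.
  apply: (@open_comp _ _ (fun p : ambient => (iter (k + n) phi p.1.1, iter n phi p.2))) => // p _.
  apply: continuous_pair => {}p.
    apply: (@continuous_comp _ _ _ (fun p : ambient => p.1.1)).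
      by apply: continuous_comp; exact: cvg_fst.
    exact: continuous_iter.
  apply: continuous_comp; [exact: cvg_snd|exact: continuous_iter].
rewrite predeqE in VE.
apply/seteqP; split=> g [] => [kg lg|[/= Vg Wg] lg]; split => //.
  have l0 : groupoid_layer k%:Z 0 g.
    have [dg sg] := kg; split => // i _.
    by rewrite -PoszD absz_nat sg -iterD addnC.
  split; first by have [] := (VE g).1 (conj kg (layer_le (leq0n n) l0)).
  have [_ /(_ n (leq0n n))] := l0; rewrite -PoszD absz_nat /Wn /= => -> ; exact: Wxx.
suff ln : groupoid_layer k%:Z n g by have [] := (VE g).2 (conj Vg ln).
have [dg gn] := lg; split => // i; rewrite leq_eqVlt => /predU1P[<-|/gn//].
apply: Winj; rewrite -?PoszD ?absz_nat //.
by have := gn n.+1 (leqnn _); rewrite -PoszD absz_nat addnS.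
Qed.

(** Within degree [k] the complement is the condition [phi^k x <> y], which is open because [X] is
    Hausdorff; the other degrees miss the graph. *)
Lemma closed_on_graph k : closed (@on_graph X phi k).
Proof.
rewrite -openC open_groupoidE => l n _; have [->|lk] := eqVneq l k%:Z; last first.
  exists setT; first exact: openT.
  apply/seteqP; split=> g [] // _ [lg gn]; split => // -[dg _].
  by move: lk; rewrite -lg dg eqxx.
exists [set p : ambient | iter k phi p.1.1 <> p.2].
  apply: open_neq_continuous => // p; last exact: cvg_snd.
  apply: (@continuous_comp _ _ _ (fun p : ambient => p.1.1)).
    by apply: continuous_comp; exact: cvg_fst.
  exact: continuous_iter.
apply/seteqP; split=> g [] /= ng lg; split => //.
  by move=> E; apply: ng; split; [case: lg|exact/esym].
by move=> [_ sg]; apply: ng; exact/esym.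
Qed.

Lemma compact_on_graph k : compact (@on_graph X phi k).
Proof.
suff -> : @on_graph X phi k = graph_elt k @` setT.
  by apply: continuous_compact => //; exact/continuous_subspaceT/continuous_graph_elt.
apply/seteqP; split=> [g /on_graphE ->|_ [x _ <-]]; last by [].
by exists (grange g).
Qed.

(** The graph is open and closed, so extension by zero keeps continuity; it is compact, so the
    support is compact. *)
Lemma Cc_glift k (a : X -> R[i]) :
  continuous (a : X -> R[i]^o) -> Cc_groupoid (glift k a : groupoid phi -> R[i]).
Proof.
move=> ca; split; last first.
  apply: (@subclosed_compact _ _ (on_graph k)) => //.
  - exact: closed_closure.
  - exact: compact_on_graph.
  - move=> g; rewrite [on_graph k](closure_id _).1; last exact: closed_on_graph.
    by apply: closureS => h /glift_neq0.
apply/continuousP => A oA.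
have -> : glift k a @^-1` A = (on_graph k `&` (@grange X phi @^-1` (a @^-1` A)))
    `|` (~` on_graph k `&` [set g : groupoid phi | A 0]).
  apply/seteqP; split=> g /=.
    have [kg|kg] := pselect (on_graph k g); first by rewrite gliftT//; left.
    by rewrite gliftF//; right.
  by case=> -[kg]; rewrite ?(gliftT _ kg) ?(gliftF _ kg).
apply: openU; apply: openI.
- exact: open_on_graph.
- move/continuousP: continuous_grange; apply.
  by move/continuousP: ca; exact.
- by rewrite openC; exact: closed_on_graph.
- have [A0|A0] := pselect (A 0).
    by rewrite (_ : [set _ | _] = setT); [exact: openT|apply/seteqP; split].
  by rewrite (_ : [set _ | _] = set0); [exact: open0|apply/seteqP; split].
Qed.

End groupoid_topology.

(** * The reduced norm on the unit space *)

Section complex_norm.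
Context {R : realType}.
Implicit Types z : R[i].

Lemma norm_normc z : `|z| = (normc z)%:C.
Proof. by []. Qed.

Lemma normc_ge0 z : 0 <= normc z.
Proof. by rewrite -lecR -norm_normc normr_ge0. Qed.

Lemma normc_conj z : normc z^* = normc z.
Proof. by apply: complexI; rewrite -!norm_normc normcJ. Qed.

Lemma normc_cvgP (T : Type) (F : set_system T) (f : T -> R[i]) (l : R[i]) :
  Filter F -> (f @ F --> (l : R[i]^o)) <->
  (forall e : R, 0 < e -> \forall t \near F, normc (l - f t) <= e).
Proof.
move=> FF; split=> [/(@cvgrPdist_le R[i] R[i]^o) fl e e0|fl].
  have := fl e%:C; rewrite ltcR => /(_ e0); apply: filterS => t.
  by rewrite norm_normc lecR.
apply/(@cvgrPdist_le R[i] R[i]^o) => -[r i] e0.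
(* In the order of the complex numbers, a positive element has imaginary part 0. *)
have /andP[/eqP /= i0 /= r0] : (i == 0) && (0 < r) by exact: e0.
by rewrite i0; have := fl _ r0; apply: filterS => t; rewrite norm_normc lecR.
Qed.

End complex_norm.

Section star_algebra.
Context {R : realType} {X : topologicalType} {phi : X -> X}.

Lemma alg_star_closed : star_algebra_closed (@alg_star R X phi).
Proof.
split=> [f h Af Ah B|l f Af B|f h Af Ah B|f Af B] [cB CB];
  have [addB scaleB mulB starB] := cB.
- by apply: addB; [apply: Af|apply: Ah].
- by apply: scaleB; apply: Af.
- by apply: mulB; [apply: Af|apply: Ah].
- by apply: starB; apply: Af.
Qed.

Lemma alg_star_Cc (f : groupoid phi -> R[i]) : Cc_groupoid f -> alg_star f.
Proof. by move=> Cf B [_]; apply. Qed.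

End star_algebra.

Section reduced_norm.
Context {R : realType} {X : topologicalType} {phi : X -> X}.
Implicit Types (f h : groupoid phi -> R[i]) (a : X -> R[i]).

Lemma le_l2norm x f h :
  (forall g, gsource g = x -> normc (f g) <= normc (h g)) ->
  (l2norm x f <= l2norm x h)%E.
Proof.
move=> fh; rewrite /l2norm lee_sqrt; last first.
  by apply: esum_ge0 => g _; rewrite lee_fin sqr_ge0.
apply: le_esum => g xg; rewrite lee_fin lerXn2r ?nnegrE ?normc_ge0//.
exact: fh.
Qed.

Lemma l2norm_single x g (f : groupoid phi -> R[i]) : gsource g = x ->
  (forall s, f s != 0 -> s = g) -> l2norm x f = (normc (f g))%:E.
Proof.
move=> xg fg; rewrite /l2norm (_ : esum _ _ = ((normc (f g)) ^+ 2)%:E).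
  by rewrite EFin_expe sqrte_sqr gee0_abs// lee_fin normc_ge0.
rewrite -[RHS](@esum_set1 R _ g (fun s => ((normc (f s)) ^+ 2)%:E)); last first.
  by rewrite lee_fin sqr_ge0.
rewrite [LHS]esum_mkcond [RHS]esum_mkcond; apply: eq_esum => h _.
case: ifPn => [_|]; case: ifPn => //.
  rewrite notin_setE => hg; apply/eqP; rewrite eqe sqrf_eq0.
  by apply/eqP; have [->|/fg//] := eqVneq (f h) 0; rewrite Normc.normc0.
by rewrite inE => ->; rewrite notin_setE.
Qed.

Lemma l2norm_ge x g f : gsource g = x -> ((normc (f g))%:E <= l2norm x f)%E.
Proof.
move=> xg; pose fg (s : groupoid phi) := if s == g then f s else 0.
rewrite [leLHS](_ : _ = l2norm x fg); last first.
  by rewrite (l2norm_single xg) /fg ?eqxx// => s; have [//|_] := eqVneq s g; rewrite eqxx.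
apply: le_l2norm => h _; rewrite /fg; case: ifP => // _.
by rewrite Normc.normc0 normc_ge0.
Qed.

(** Each finite partial sum for [f] is at most [e ^+ 2] times the corresponding one for [h]; this
    bounds the norm of multiplication operators. *)
Lemma l2norm_le_scaled x (e : R) f h : 0 <= e -> (l2norm x h <= 1)%E ->
  (forall g, gsource g = x -> normc (f g) <= e * normc (h g)) ->
  (l2norm x f <= e%:E)%E.
Proof.
move=> e0 h1 fh.
have {}h1 : (\esum_(g in source_fibre x) ((normc (h g)) ^+ 2)%:E <= 1)%E.
  by rewrite -(@lee_sqrt R)// [leRHS]/= sqrtr1.
have -> : e%:E = sqrte (e ^+ 2)%:E by rewrite EFin_expe sqrte_sqr gee0_abs.
rewrite /l2norm lee_sqrt ?lee_fin ?sqr_ge0//.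
apply: ge_ereal_sup => _ [S [finS Sx] <-].
apply: (@le_trans _ _ ((e ^+ 2)%:E * \sum_(g \in S) ((normc (h g)) ^+ 2)%:E)%E).
  rewrite !fsbig_finite// !sumEFin -EFinM lee_fin mulr_sumr.
  rewrite big_seq [leRHS]big_seq; apply: ler_sum => g.
  rewrite in_fset_set// => /set_mem/Sx xg.
  by rewrite -exprMn lerXn2r ?nnegrE ?mulr_ge0 ?normc_ge0// fh.
rewrite -[leRHS]mule1; apply: lee_wpmul2l; first by rewrite lee_fin sqr_ge0.
by apply: le_trans h1; apply: esum_ge; exists S.
Qed.

(** Apply the representation over [x] to the unit vector concentrated at the unit of [x]: the
    coordinate of the image at that unit is [f (gunit phi x)]. *)
Lemma reduced_norm_ge f x : ((normc (f (gunit phi x)))%:E <= reduced_norm f)%E.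
Proof.
pose d (g : groupoid phi) : R[i] := if g == gunit phi x then 1 else 0.
have d1 : l2norm x d = 1%E.
  rewrite (@l2norm_single _ (gunit phi x)) /d ?eqxx ?Normc.normc1// => s.
  by have [//|_] := eqVneq s (gunit phi x); rewrite eqxx.
have -> : f (gunit phi x) = regular_rep f d (gunit phi x).
  rewrite /regular_rep (fsbig_single (t := (gunit phi x, gunit phi x))) /=.
  - by rewrite /d eqxx mulr1.
  - by split => //=; rewrite /gdeg /= addr0.
  - move=> [g1 g2] /= [s1r2 rg dg sg]; rewrite /d.
    have [g2x _|_] := eqVneq g2 (gunit phi x); last by rewrite mulr0 eqxx.
    rewrite g2x; congr pair; apply: groupoid_ext.
    + exact/esym.
    + by move: dg; rewrite g2x => /esym; apply: etrans; rewrite addr0.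
    + by rewrite s1r2 g2x.
apply: le_trans (l2norm_ge _ _) _; first by [].
apply: (@le_trans _ _ (regular_rep_norm x f)); last first.
  by apply: ereal_sup_ubound; exists x.
by apply: ereal_sup_ubound; exists d => //=; rewrite d1.
Qed.

Lemma reduced_norm_glift0 a (e : R) : (forall x, normc (a x) <= e) ->
  (reduced_norm (glift 0 a : groupoid phi -> R[i]) <= e%:E)%E.
Proof.
move=> ae; apply: ge_ereal_sup => _ [x _ <-].
have e0 : 0 <= e := le_trans (normc_ge0 _) (ae x).
apply: ge_ereal_sup => _ [xi /= xi1 <-]; rewrite regular_rep_glift0.
apply: l2norm_le_scaled xi1 _ => // g _.
by rewrite Normc.normcM ler_wpM2r ?normc_ge0.
Qed.

End reduced_norm.

(** * The algebra [D] as a uniform closure *)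

Section D_groupoid_description.
Context {R : realType} {X : topologicalType} {phi : X -> X}.
Implicit Types (a b : X -> R[i]).

(** The elements of [unit_supported], read as functions on [X]. *)
Definition D_alg a : Prop := alg_star (glift 0 a : groupoid phi -> R[i]).

Lemma unit_supported_glift a :
  D_alg a -> unit_supported (glift 0 a : groupoid phi -> R[i]).
Proof.
move=> Da; split => // g /glift_neq0/on_graphE ->.
by exists (grange g); rewrite gunitE.
Qed.

Lemma unit_supportedE (f : groupoid phi -> R[i]) : unit_supported f ->
  f = glift 0 (fun x => f (gunit phi x)).
Proof.
move=> [_ fU]; apply/funext => g; have [g0|g0] := pselect (on_graph 0 g).
  by rewrite gliftT// gunitE -(on_graphE g0).
rewrite gliftF//; apply/eqP; apply: contra_notT g0 => /fU[x ->].
by split.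
Qed.

Lemma D_algD a b : D_alg a -> D_alg b -> D_alg (fun x => a x + b x).
Proof.
by rewrite /D_alg gliftD => Da Db; have [+ _ _ _] := @alg_star_closed R X phi; apply.
Qed.

Lemma D_algZ (l : R[i]) a : D_alg a -> D_alg (fun x => l * a x).
Proof.
by rewrite /D_alg gliftZ => Da; have [_ + _ _] := @alg_star_closed R X phi; apply.
Qed.

Lemma D_algM a b : D_alg a -> D_alg b -> D_alg (fun x => a x * b x).
Proof.
rewrite /D_alg => Da Db; rewrite -conv_glift0.
by have [_ _ + _] := @alg_star_closed R X phi; apply.
Qed.

Lemma D_alg_conj a : D_alg a -> D_alg (fun x => (a x)^*).
Proof.
rewrite /D_alg => Da; rewrite -star_glift0.
by have [_ _ _] := @alg_star_closed R X phi; apply.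
Qed.

Lemma D_algB a b : D_alg a -> D_alg b -> D_alg (fun x => a x - b x).
Proof.
move=> Da Db; have := D_algD Da (D_algZ (-1) Db).
by congr D_alg; apply/funext => x; rewrite mulN1r.
Qed.

(* On the unit space the reduced norm is the supremum norm, so the closure may
   be taken uniformly on [X]. *)
Lemma D_groupoidP a : @D_groupoid R X phi a <->
  forall e : R, 0 < e -> exists2 b, D_alg b & forall x, normc (a x - b x) <= e.
Proof.
split=> [[u [_ uS] ua] e e0|Da].
  have [f Sf [N uN]] := uS _ e0; have fE := unit_supportedE Sf.
  exists (fun x => f (gunit phi x)).
    by rewrite /D_alg -fE; case: Sf.
  (* The convergence of [u] to [a] is only known pointwise, so the index [M] depends on [x]; the
     extra error [r] is arbitrary and disappears. *)
  move=> x; apply/ler_addgt0Pr => r r0.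
  have /normc_cvgP/(_ _ r0)[M _ uM] := ua x.
  have NM := leq_maxl N M; have MN := leq_maxr N M.
  have := uM _ MN; have := le_trans (reduced_norm_ge _ x) (ltW (uN _ NM)).
  rewrite lee_fin; set v := u _ _; set w := f _ => vw va.
  rewrite (_ : a x - w = (v - w) + (a x - v)); last by rewrite [RHS]addrC addrA subrK.
  by rewrite (le_trans (le_normcD _ _))// lerD.
have /choice[b bP] : forall n : nat, exists b, D_alg b /\
    forall x, normc (a x - b x) <= n.+1%:R^-1.
  move=> n; have [|b Db ab] := Da n.+1%:R^-1; first by rewrite invr_gt0 ltr0n.
  by exists b.
have inv0 (e : R) : 0 < e -> exists N, forall n, (N <= n)%N -> n.+1%:R^-1 <= e.
  move=> e0; have [N _ Ne] := near_infty_natSinv_lt (PosNum e0).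
  by exists N => n /Ne /ltW.
have bb (e : R) : 0 < e -> exists N, forall m n, (N <= m)%N -> (N <= n)%N ->
    (reduced_norm (fun g : groupoid phi => (glift 0 (b m) g - glift 0 (b n) g)%R : R[i]) < e%:E)%E.
  (* Two errors of at most [e / 4] leave room for the strict inequality. *)
  move=> e0; have [|N NP] := inv0 (e / 4); first by rewrite divr_gt0.
  exists N => m n Nm Nn; rewrite -gliftB.
  apply: (@le_lt_trans _ _ (e / 4 + e / 4)%:E); last first.
    by rewrite lte_fin; lra.
  apply: reduced_norm_glift0 => x.
  rewrite (_ : b m x - b n x = (a x - b n x) - (a x - b m x)); last first.
    by rewrite opprB [RHS]addrC addrA subrK.
  rewrite (le_trans (le_normcD _ _))// normcN lerD//.
    by rewrite (le_trans ((bP n).2 x))// NP.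
  by rewrite (le_trans ((bP m).2 x))// NP.
have bS n : unit_supported (glift 0 (b n) : groupoid phi -> R[i]).
  exact: unit_supported_glift (bP n).1.
exists (fun n => glift 0 (b n)).
  split; first by split=> [n|]; [exact: (bP n).1|exact: bb].
  move=> e /bb[N NP]; exists (glift 0 (b N)) => //.
  by exists N => n Nn; exact: NP.
move=> x; apply/normc_cvgP => e /inv0[N NP]; exists N => // n /= Nn.
by rewrite glift_gunit (le_trans ((bP n).2 x))// NP.
Qed.

Local Notation D := (@D_groupoid R X phi).

Lemma D_groupoid_alg a : D_alg a -> D a.
Proof.
move=> Da; apply/D_groupoidP => e e0; exists a => // x.
by rewrite subrr Normc.normc0 ltW.
Qed.

Lemma D_groupoidD a b : D a -> D b -> D (fun x => a x + b x).
Proof.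
move=> /D_groupoidP Da /D_groupoidP Db; apply/D_groupoidP => e e0.
have e2 : 0 < e / 2 by rewrite divr_gt0.
have [a' Da' aa'] := Da _ e2; have [b' Db' bb'] := Db _ e2.
exists (fun x => a' x + b' x); first exact: D_algD.
move=> x; rewrite opprD addrACA (le_trans (le_normcD _ _))//.
by rewrite [leRHS](splitr e) lerD.
Qed.

Lemma D_groupoid_conj a : D a -> D (fun x => (a x)^*).
Proof.
move=> /D_groupoidP Da; apply/D_groupoidP => e /Da[a' Da' aa'].
exists (fun x => (a' x)^*); first exact: D_alg_conj.
by move=> x; rewrite -rmorphB normc_conj.
Qed.

(* The boundedness assumption spares a proof that all elements of [D] are
   bounded functions. *)
Lemma D_groupoidM a b (M : R) : D_alg b -> (forall x, normc (b x) <= M) ->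
  D a -> D (fun x => b x * a x).
Proof.
move=> Db bM /D_groupoidP Da; apply/D_groupoidP => e e0.
(* Adding 1 gives a positive divisor even when [M] is 0. *)
have M1 : 0 < `|M| + 1 by rewrite ltr_wpDl.
have [|a' Da' aa'] := Da (e / (`|M| + 1)); first by rewrite divr_gt0.
exists (fun x => b x * a' x); first exact: D_algM.
move=> x; rewrite -mulrBr Normc.normcM.
rewrite [leRHS](_ : _ = (`|M| + 1) * (e / (`|M| + 1))); last first.
  by rewrite mulrCA divff ?mulr1// gt_eqF.
apply: ler_pM; rewrite ?normc_ge0//.
by rewrite (le_trans (bM x))// (le_trans (ler_norm _))// lerDl.
Qed.

(** A map that does not increase uniform distances carries approximations of [a] to approximations
    of [T a]. It serves for composition with [phi] and for the weighted transfer operators. *)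
Lemma D_groupoid_extend (T : (X -> R[i]) -> X -> R[i]) :
  (forall a, D_alg a -> D_alg (T a)) ->
  (forall a b (e : R), (forall x, normc (a x - b x) <= e) ->
     forall x, normc (T a x - T b x) <= e) ->
  forall a, D a -> D (T a).
Proof.
move=> TD Te a /D_groupoidP Da; apply/D_groupoidP => e /Da[a' Da' aa'].
by exists (T a'); [exact: TD|exact: Te].
Qed.

End D_groupoid_description.

Arguments D_alg {R X} phi a.

(** * Partitions of unity and the transfer operator *)

(* Normalised tent functions on balls over which [phi] is injective; squares
   are used because [f] will occur on both sides of an element of the
   algebra. *)
Lemma injective_partition (R : realType) (X : topologicalType) (phi : X -> X) :
  [set: X] !=set0 -> compact [set: X] -> metrizable R X -> locally_injective phi ->
  exists n (f : 'I_n -> X -> R),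
    [/\ forall i, continuous (f i),
        forall i x y, phi x = phi y -> f i x != 0 -> f i y != 0 -> x = y &
        forall x, \sum_i f i x ^+ 2 = 1].
Proof.
move=> [x0 _] cX [d [d0 dE dC dT nb]] [B [oB nB] injB].
(* The covering form of compactness is stated for pointed spaces; [x0] is the point. *)
pose Xp : ptopologicalType := HB.pack (Topological.sort X) (Topological.class X)
  (isPointed.Build (Topological.sort X) x0).
have dxx x : d x x = 0 by apply/dE.
have nball x (e : R) : 0 < e -> nbhs x [set y | d x y < e].
  by move=> e0; rewrite nb; exists e.
have /choice[r rP] x : exists r : R, 0 < r /\
    forall y z, d x y < r -> d x z < r -> phi y = phi z -> y = z.
  have [U [BU Ux] _] := nB x setT filterT.
  have : nbhs x U by apply: open_nbhs_nbhs; split => //; exact: oB.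
  rewrite nb => -[r /= r0 rU]; exists r; split => // y z xy xz.
  by apply: (injB U BU); apply/mem_set/rU.
have cd x : continuous (d x).
  move=> y; apply/cvgrPdist_lt => e e0; apply: filterS (nball y e e0) => z /= yz.
  have := dT x y z; have := dT x z y; rewrite (dC z y) ltr_norml => *.
  by apply/andP; split; lra.
pose h x y : R := Num.max 0 (r x - d x y).
have h0 x y : 0 <= h x y by rewrite le_max lexx.
have hd x y : (h x y != 0) = (d x y < r x).
  by rewrite -subr_gt0 /h; case: ltP => [/gt_eqF ->|]; rewrite ?eqxx.
have ch x : continuous (h x).
  move=> y; apply: (@continuous_max R X (cst 0) (fun z => r x - d x z)).
    exact: cvg_cst.
  by apply: cvgB; [exact: cvg_cst|exact: cd].
have : @cover_compact Xp [set: X] by rewrite -compact_cover.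
move=> /(_ _ [set: X] (fun x => [set y | d x y < r x]))[||s _ sX].
- move=> x _; rewrite (_ : [set _ | _] = d x @^-1` [set t | t < r x])//.
  by apply: open_comp => // *; exact: cd.
- by move=> x _; exists x => //=; rewrite dxx; case: (rP x).
pose c := in_tuple (enum_fset s).
pose u x := \sum_i h (tnth c i) x ^+ 2.
have u0 x : 0 < u x.
  have [z /= zs zx] := sX x I.
  have /tnthP[i zi] : z \in c by [].
  rewrite /u (bigD1 i)//= ltr_pwDl//.
    by rewrite exprn_even_gt0//= -zi hd.
  by apply: sumr_ge0 => j _; rewrite sqr_ge0.
exists _, (fun i x => h (tnth c i) x / Num.sqrt (u x)); split.
- move=> i x; apply: cvgM; first exact: ch.
  apply: cvgV; first by rewrite sqrtr_eq0 -ltNge.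
  apply: continuous_comp; last exact: sqrt_continuous.
  apply: cvg_big => [|j _]; first exact: add_continuous.
  exact: (cvgM (ch (tnth c j) x) (ch (tnth c j) x)).
- move=> i x y E; rewrite !mulf_eq0 !negb_or => /andP[+ _] /andP[+ _].
  by rewrite !hd => xi yi; have [_] := rP (tnth c i); apply.
- move=> x; under eq_bigr do rewrite expr_div_n sqr_sqrtr ?ltW//.
  by rewrite -mulr_suml -/(u x) divff// gt_eqF.
Qed.

Section transfer_operator.
Context {R : realType} {X : topologicalType} {phi : X -> X}.
Implicit Types (a b q : X -> R[i]).
Local Notation T q a := (transfer phi (fun x => q x * a x)).

Definition injective_support q : Prop :=
  forall x y, phi x = phi y -> q x != 0 -> q y != 0 -> x = y.

Lemma transfer_at q a x : injective_support q -> q x != 0 ->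
  T q a (phi x) = q x * a x.
Proof.
move=> qinj qx; rewrite /transfer (fsbig_single (t := x))// => y /= yx.
by rewrite mulf_eq0 => /norP[qy _]; exact: qinj.
Qed.

(** The fibre over [y] meets the support of [q] in at most one point, the same for every [a]. The
    identities below thereby become pointwise ones at that point. *)
Lemma transfer_cases q y : injective_support q ->
  (exists2 x, phi x = y & forall a, T q a y = q x * a x) \/
  forall a, T q a y = 0.
Proof.
move=> qinj; have [[x [<- qx]]|nx] := pselect (exists x, phi x = y /\ q x != 0).
  by left; exists x => // a; exact: transfer_at.
right=> a; apply: fsbig1 => x /= xy; apply/eqP; rewrite mulf_eq0.
by apply/orP; left; apply: contra_notT nx => qx; exists x.
Qed.

Context (q : X -> R[i]).
Context (qinj : injective_support q).

Lemma transferD a b : T q (fun x => a x + b x) = (fun y => T q a y + T q b y).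
Proof.
apply/funext => y; have [[x _ E]|E] := transfer_cases y qinj.
  by rewrite !E mulrDr.
by rewrite !E addr0.
Qed.

Lemma transferZ (l : R[i]) a : T q (fun x => l * a x) = (fun y => l * T q a y).
Proof.
apply/funext => y; have [[x _ E]|E] := transfer_cases y qinj.
  by rewrite !E mulrCA.
by rewrite !E mulr0.
Qed.

Lemma transfer_comp a b :
  T q (fun x => a x * b (phi x)) = (fun y => T q a y * b y).
Proof.
apply/funext => y; have [[x xy E]|E] := transfer_cases y qinj.
  by rewrite !E xy mulrA.
by rewrite !E mul0r.
Qed.

(** Both sides are [q x ^+ 2 * a x * b x] at the surviving point [x]. This is what makes
    [a |-> d (T q a) / d (T q 1)] multiplicative. *)
Lemma transferM a b :
  (fun y => T q a y * T q b y) =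
  (fun y => T q (fun=> 1) y * T q (fun x => a x * b x) y).
Proof.
apply/funext => y; have [[x xy E]|E] := transfer_cases y qinj.
  by rewrite !E mulr1 mulrACA -!mulrA.
by rewrite !E.
Qed.

Lemma transfer_conj a : (forall x, (q x)^* = q x) ->
  T q (fun x => (a x)^*) = (fun y => (T q a y)^*).
Proof.
move=> qr; apply/funext => y; have [[x xy E]|E] := transfer_cases y qinj.
  by rewrite !E rmorphM/= qr.
by rewrite !E conjc0.
Qed.

Lemma transfer_self : T q q = (fun y => T q (fun=> 1) y * T q (fun=> 1) y).
Proof.
apply/funext => y; have [[x xy E]|E] := transfer_cases y qinj.
  by rewrite !E mulr1.
by rewrite !E mulr0.
Qed.

(** Where [q x] is nonzero, [x] itself is the point of its fibre that survives in the sum. *)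
Lemma mul_comp_transfer a :
  (fun x => q x * T q a (phi x)) = (fun x => q x * (q x * a x)).
Proof.
apply/funext => x; have [->|qx] := eqVneq (q x) 0; first by rewrite !mul0r.
by rewrite transfer_at.
Qed.

Lemma normc_transfer a (e : R) y : (forall x, normc (q x) <= 1) ->
  0 <= e -> (forall x, normc (a x) <= e) -> normc (T q a y) <= e.
Proof.
move=> q1 e0 ae; have [[x xy E]|E] := transfer_cases y qinj; rewrite E.
  rewrite Normc.normcM (le_trans (ler_wpM2r (normc_ge0 _) (q1 x)))//.
  by rewrite mul1r.
by rewrite Normc.normc0.
Qed.

End transfer_operator.

(** * Stability of [D] under composition and transfer *)

Section D_groupoid_operations.
Context {R : realType} {X : topologicalType} {phi : X -> X}.
Context (X_compact : compact [set: X]).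
Context (X_hausdorff : hausdorff_space X).
Context (phi_continuous : continuous phi).
Context (phi_locally_injective : locally_injective phi).
Implicit Types (a b q : X -> R[i]).

Lemma alg_star_glift k a : continuous (a : X -> R[i]^o) ->
  alg_star (glift k a : groupoid phi -> R[i]).
Proof. by move=> ca; apply: alg_star_Cc; exact: Cc_glift. Qed.

Lemma D_alg_continuous a : continuous (a : X -> R[i]^o) -> D_alg phi a.
Proof. exact: alg_star_glift. Qed.

Lemma D_alg_cst (l : R[i]) : D_alg phi (fun=> l).
Proof. by apply: D_alg_continuous => x; exact: cvg_cst. Qed.

(** With [v] the indicator function of the graph of [phi], the product of [star v], [a] and [v] is
    the transfer of [a]. *)
Lemma D_alg_transfer a : D_alg phi a -> D_alg phi (transfer phi a).
Proof.
move=> Da; have [_ _ mulA starA] := @alg_star_closed R X phi.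
have A1 : alg_star (glift 1 (fun=> 1) : groupoid phi -> R[i]).
  by apply: alg_star_glift => x; exact: cvg_cst.
have := mulA _ _ (starA _ A1) (mulA _ _ Da A1).
rewrite conv_glift0 conv_star_glift1; congr (alg_star (glift 0 _)).
apply/funext => y; apply: eq_fsbigr => x _.
by rewrite conjc1 mul1r mulr1.
Qed.

Lemma D_alg_sum (I : Type) (s : seq I) (F : I -> X -> R[i]) :
  (forall i, D_alg phi (F i)) -> D_alg phi (fun x => \sum_(i <- s) F i x).
Proof.
move=> DF; elim: s => [|i s IH].
  by under eq_fun do rewrite big_nil; exact: D_alg_cst.
by under eq_fun do rewrite big_cons; exact: D_algD.
Qed.

Context (n : nat) (f : 'I_n -> X -> R).
Context (f_continuous : forall i, continuous (f i)).
Context (f_injective : forall i x y,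
  phi x = phi y -> f i x != 0 -> f i y != 0 -> x = y).
Context (f_partition : forall x, \sum_i f i x ^+ 2 = 1).

Lemma continuous_complex (T : topologicalType) (g : T -> R) :
  continuous g -> continuous (fun x => (g x)%:C : R[i]^o).
Proof.
move=> cg x; apply/normc_cvgP => e e0.
near=> t; have gt : `|g x - g t| <= e.
  by near: t; exact: (cvgrPdist_le g (g x)).1 (cg x) e e0.
by rewrite -rmorphB /= /normc expr0n /= addr0 sqrtr_sqr.
Unshelve. all: by end_near. Qed.

(** The member [p_i] of the partition of unity, of which [f i] is a square root up to sign. *)
Definition weight i x : R[i] := (f i x ^+ 2)%:C.

Lemma weight_injective i : @injective_support R X phi (weight i).
Proof.
move=> x y xy; rewrite /weight !rmorphXn /= !expf_eq0 /= => fx fy.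
by apply: (f_injective xy (i := i)); [move: fx|move: fy];
  apply: contra => /eqP ->.
Qed.

Lemma weight_le1 i x : normc (weight i x) <= 1.
Proof.
rewrite -lecR -norm_normc ger0_norm /weight ?lecR ?sqr_ge0//.
rewrite -(f_partition x) (bigD1 i)//= lerDl.
by apply: sumr_ge0 => j _; rewrite sqr_ge0.
Qed.

Lemma sum_weight x : \sum_i weight i x = 1.
Proof. by rewrite -rmorph_sum f_partition. Qed.

Lemma D_alg_weight i : D_alg phi (weight i).
Proof.
apply: D_alg_continuous; apply: continuous_complex => x.
exact: (cvgM (@f_continuous i x) (@f_continuous i x)).
Qed.

(** With [v_i] the lift of [f i] to the graph of [phi], the product of [v_i], [a] and [star v_i] is
    [p_i * (a \o phi)] by injectivity on the support; summing over [i] gives [a \o phi]. *)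
Lemma D_alg_comp a : D_alg phi a -> D_alg phi (a \o phi).
Proof.
move=> Da; have [_ _ mulA starA] := @alg_star_closed R X phi.
have Af i : alg_star (glift 1 (fun x => (f i x)%:C) : groupoid phi -> R[i]).
  by apply: alg_star_glift; exact: continuous_complex.
have -> : a \o phi = (fun x => \sum_i weight i x * a (phi x)).
  by apply/funext => x; rewrite -mulr_suml sum_weight mul1r.
apply: D_alg_sum => i.
have := mulA _ _ (Af i) (mulA _ _ Da (starA _ (Af i))).
rewrite conv_glift1_sandwich => [|x y xy fx fy].
  congr (alg_star (glift 0 _)); apply/funext => x.
  by rewrite conjc_real /weight expr2 rmorphM.
by apply: (f_injective xy (i := i)); [move: fx|move: fy];
  apply: contra => /eqP ->.
Qed.

Local Notation D := (@D_groupoid R X phi).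

Lemma D_groupoid_comp a : D a -> D (a \o phi).
Proof.
apply: (@D_groupoid_extend _ _ _ (fun a => a \o phi)); first exact: D_alg_comp.
by move=> b c e bc x; exact: bc.
Qed.

(** One term with weight at most 1 survives in each fibre, so the operator is contractive for the
    uniform norm and passes to the closure. *)
Lemma D_groupoid_transfer i a :
  D a -> D (transfer phi (fun x => weight i x * a x)).
Proof.
apply: (@D_groupoid_extend _ _ _ (fun a => transfer phi (fun x => weight i x * a x))).
  by move=> b Db; apply: D_alg_transfer; apply: D_algM => //; exact: D_alg_weight.
move=> b c e bc y.
have e0 : 0 <= e := le_trans (normc_ge0 _) (bc y).
have wi := @weight_injective i.
have -> : transfer phi (fun x => weight i x * b x) y -
          transfer phi (fun x => weight i x * c x) y =
    transfer phi (fun x => weight i x * (b x + (-1) * c x)) y.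
  by rewrite transferD// transferZ// mulN1r.
apply: normc_transfer => //; first exact: weight_le1.
by move=> x; rewrite mulN1r.
Qed.

End D_groupoid_operations.

(** * Cardinality of the fibres *)

Section transfer_count.
Context {R : realType} {X : topologicalType} {phi : X -> X}.
Context (phi_surjective : forall y : X, exists x : X, phi x = y).
Context (n : nat) (f : 'I_n -> X -> R).
Context (f_injective : forall i x y,
  phi x = phi y -> f i x != 0 -> f i y != 0 -> x = y).
Context (f_partition : forall x, \sum_i f i x ^+ 2 = 1).

(** At each point some [f i] is nonzero, and each [f i] is nonzero at no more than one point of the
    fibre. *)
Lemma finite_fibre y : finite_set (phi @^-1` [set y]).
Proof.
apply: (@sub_finite_set _ _
    (\bigcup_(i in [set: 'I_n]) [set x | phi x = y /\ f i x != 0])).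
  move=> x /= xy; apply: contrapT => nx.
  have := f_partition x; rewrite big1 => [/esym/eqP|i _]; first by rewrite oner_eq0.
  apply/eqP; rewrite expf_eq0 /=; apply/negPn/negP => fx.
  by apply: nx; exists i.
apply: bigcup_finite => // i _.
have [[z [zy fz]]|nz] := pselect (exists z, phi z = y /\ f i z != 0).
  apply: (@sub_finite_set _ _ [set z]) => [x [xy fx]|]; last exact: finite_set1.
  by apply: (f_injective _ fx fz); rewrite xy zy.
apply: (@sub_finite_set _ _ set0) => [x [xy fx]|]; last exact: finite_set0.
by apply: nz; exists x.
Qed.

(* The sum is the number of preimages of [y]. *)
Lemma transfer_count y : exists2 m, (0 < m <= n)%N &
  \sum_i transfer phi (fun x => weight f i x * 1) y = m%:R.
Proof.
have fin := finite_fibre y; pose s := fset_set (phi @^-1` [set y]).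
have E : \sum_i transfer phi (fun x => weight f i x * 1) y = (size (enum_fset s))%:R.
  under eq_bigr do rewrite /transfer fsbig_finite//.
  (* Summing over [i] first, each preimage contributes the total weight 1. *)
  rewrite exchange_big /=; under eq_bigr do rewrite -mulr_suml sum_weight// mulr1.
  by rewrite big_const_seq count_predT iter_addr_0.
exists (size (enum_fset s)) => //; apply/andP; split.
  have [x xy] := phi_surjective y.
  have : x \in s by rewrite in_fset_set// mem_set.
  by rewrite -has_predT => xs; apply/hasP; exists x.
(* Each of the [n] transfers has modulus at most 1, which bounds the number of preimages by [n]. *)
have : `|\sum_i transfer phi (fun x => weight f i x * 1) y| <= n%:R :> R[i].
  rewrite (le_trans (ler_norm_sum _ _ _))//.
  rewrite -[in leRHS](card_ord n) -sum1_card natr_sum; apply: ler_sum => i _.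
  rewrite norm_normc lecR; apply: normc_transfer => //.
  - exact: weight_injective.
  - exact: weight_le1.
  - by move=> _; rewrite Normc.normc1.
by rewrite E normr_nat ler_nat.
Qed.

End transfer_count.

(** * Characters as functionals *)

Section characters.
Context {R : realType} {X : topologicalType} {phi : X -> X}.
Local Notation D := (@D_groupoid R X phi).
Implicit Types (a b : X -> R[i]).

(* A character as a function of all [X -> R[i]], with junk value 0 outside
   [D]. *)
Definition char_ext (c : D -> R[i]) a : R[i] :=
  if pselect (D a) is left Da then c (exist _ a (mem_set Da)) else 0.

Lemma char_ext_val c (s : D) : char_ext c (\val s) = c s.
Proof.
rewrite /char_ext; case: pselect => [Da|]; last by have := valP s; rewrite inE.
by congr c; exact: val_inj.
Qed.

Lemma char_extE c a (Da : D a) : char_ext c a = c (exist _ a (mem_set Da)).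
Proof. by rewrite -char_ext_val. Qed.

Section character_laws.
Context (c : D -> R[i]) (hc : character c).

Lemma char_extD a b : D a -> D b ->
  char_ext c (fun x => a x + b x) = char_ext c a + char_ext c b.
Proof.
move=> Da Db; have Ds := D_groupoidD Da Db.
by rewrite !char_extE; have [+ _ _ _ _] := hc; apply.
Qed.

Lemma char_extZ (l : R[i]) a : D a -> D (fun x => l * a x) ->
  char_ext c (fun x => l * a x) = l * char_ext c a.
Proof. by move=> Da Ds; rewrite !char_extE; have [_ + _ _ _] := hc; apply. Qed.

(** Membership of the product is a hypothesis, since [D_groupoidM] treats products with a bounded
    factor from [D_alg]. *)
Lemma char_extM a b : D a -> D b -> D (fun x => a x * b x) ->
  char_ext c (fun x => a x * b x) = char_ext c a * char_ext c b.
Proof. by move=> Da Db Ds; rewrite !char_extE; have [_ _ + _ _] := hc; apply. Qed.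

Lemma char_ext_conj a : D a ->
  char_ext c (fun x => (a x)^*) = (char_ext c a)^*.
Proof.
move=> Da; have Ds := D_groupoid_conj Da.
by rewrite !char_extE; have [_ _ _ + _] := hc; apply.
Qed.

Lemma char_ext1 : D (fun=> 1) -> char_ext c (fun=> 1) = 1.
Proof. by move=> D1; rewrite char_extE; have [_ _ _ _] := hc; apply. Qed.

End character_laws.
End characters.

(** * The weak* topology of the spectrum *)

Lemma cvg_prod_topology (I : Type) (T : I -> topologicalType)
    (F : set_system (prod_topology T)) (l : prod_topology T) : Filter F ->
  (forall i, (fun h : prod_topology T => h i) @ F --> l i) -> F --> l.
Proof.
move=> FF Fl; apply/cvg_sup => i A.
rewrite (@nbhsE (initial_topology _)) => -[B [[C oC <-] /= Cl] BA].
apply: filterS BA _; apply: (Fl i C).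
by apply: open_nbhs_nbhs; split.
Qed.

Lemma continuous_prod_topology (Z : topologicalType) (I : Type)
    (T : I -> topologicalType) (h : Z -> prod_topology T) :
  (forall i, continuous (fun z => h z i)) -> continuous h.
Proof. by move=> ch z; apply: cvg_prod_topology => i; exact: ch. Qed.

Section spectrum_topology.
Context {R : realType} {X : topologicalType} {phi : X -> X}.
Local Notation spec := (@spectrum R X phi).

Lemma continuous_eval (a : @D_groupoid R X phi) :
  continuous (fun c : spec => \val c a : R[i]^o).
Proof.
move=> c; apply: (@continuous_comp _ _ _ (\val : spec -> _)
  (fun h : {ptws @D_groupoid R X phi -> R[i]^o} => h a)).
  exact: initial_continuous.
exact: (@proj_continuous _ (fun=> R[i]^o) a).
Qed.

Lemma continuous_to_spectrum (Z : topologicalType) (h : Z -> spec) :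
  (forall a, continuous (fun z => \val (h z) a : R[i]^o)) -> continuous h.
Proof.
move=> ch; apply: continuous_comp_initial.
exact: (@continuous_prod_topology _ _ (fun=> R[i]^o)).
Qed.

End spectrum_topology.

(** * The dual map *)

Lemma continuous_ratio (K : numFieldType) (Z : topologicalType) (u v : Z -> K)
    (z : Z) : {for z, continuous u} -> {for z, continuous v} -> v z != 0 ->
  {for z, continuous (fun t => u t / v t)}.
Proof. by move=> cu cv vz; apply: cvgM => //; exact: cvgV. Qed.

Local Opaque char_ext transfer.

Section dual_map.
Context {R : realType} {X : topologicalType} {phi : X -> X}.
Context (X_compact : compact [set: X]).
Context (X_hausdorff : hausdorff_space X).
Context (phi_continuous : continuous phi).
Context (phi_locally_injective : locally_injective phi).
Context (phi_surjective : forall y : X, exists x : X, phi x = y).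
Context (n : nat) (f : 'I_n -> X -> R).
Context (f_continuous : forall i, continuous (f i)).
Context (f_injective : forall i x y,
  phi x = phi y -> f i x != 0 -> f i y != 0 -> x = y).
Context (f_partition : forall x, \sum_i f i x ^+ 2 = 1).
Implicit Types (a b : X -> R[i]).

Local Notation D := (@D_groupoid R X phi).
Local Notation spec := (@spectrum R X phi).
Local Notation w i := (weight f i).
Local Notation T i a := (transfer phi (fun x => weight f i x * a x)).
Local Notation T1 i := (transfer phi (fun x => weight f i x * 1)).

Let w_inj i : @injective_support R X phi (w i).
Proof. exact: weight_injective. Qed.

Let D_cst (l : R[i]) : D (fun=> l).
Proof. by apply: D_groupoid_alg; exact: D_alg_cst. Qed.

Let D_w i : D (w i).
Proof. by apply: D_groupoid_alg; exact: D_alg_weight. Qed.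

Let D_wM i a : D a -> D (fun x => w i x * a x).
Proof.
by apply: (@D_groupoidM _ _ _ _ _ 1); [exact: D_alg_weight|exact: weight_le1].
Qed.

Let D_T i a : D a -> D (T i a).
Proof. exact: D_groupoid_transfer. Qed.

Let D_comp a : D a -> D (a \o phi).
Proof. exact: D_groupoid_comp. Qed.

Let D_alg_T1 i : D_alg phi (T1 i).
Proof.
by apply: D_alg_transfer => //; apply: D_algM; [exact: D_alg_weight|exact: D_alg_cst].
Qed.

Let D_T1M i a : D a -> D (fun y => T1 i y * a y).
Proof.
apply: (@D_groupoidM _ _ _ _ _ 1) => // y; apply: normc_transfer => //.
  exact: weight_le1.
by move=> _; rewrite Normc.normc1.
Qed.

Lemma character_comp (c : D -> R[i]) : character c ->
  character (fun s : D => char_ext c (\val s \o phi)).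
Proof.
have Dv (s : D) : D (\val s \o phi) by exact/D_comp/set_mem/valP.
move=> hc; split=> [a b s E|l a s E|a b s E|a s E|s E].
- by rewrite E; exact: (char_extD hc (Dv a) (Dv b)).
- by rewrite E; apply: (char_extZ hc (Dv a)); have := Dv s; rewrite E.
- by rewrite E; apply: (char_extM hc (Dv a) (Dv b)); have := Dv s; rewrite E.
- by rewrite E; exact: (char_ext_conj hc (Dv a)).
- by rewrite E; exact: (char_ext1 hc (D_cst 1)).
Qed.

(** This is the preimage of [d] under the dual map. Multiplicativity is [transferM] divided by the
    square of [d (T1 i)]; compatibility with conjugation holds because the weights are real. *)
Lemma character_transfer i (d : D -> R[i]) : character d ->
  char_ext d (T1 i) != 0 ->
  character (fun s : D => char_ext d (T i (\val s)) / char_ext d (T1 i)).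
Proof.
have Dv (s : D) : D (T i (\val s)) by exact/D_T/set_mem/valP.
move=> hd t0; have tr : (char_ext d (T1 i))^* = char_ext d (T1 i).
  rewrite -(char_ext_conj hd); last exact: D_T.
  by rewrite -transfer_conj ?conjc1// => x; rewrite conjc_real.
split=> [a b s E|l a s E|a b s E|a s E|s E].
- by rewrite E transferD// (char_extD hd (Dv a) (Dv b)) mulrDl.
- rewrite E transferZ// (char_extZ hd (Dv a)) ?mulrA//.
  by have := Dv s; rewrite E transferZ.
- have TM : (fun y => T i (\val a) y * T i (\val b) y) =
      (fun y => T1 i y * T i (\val s) y) by rewrite E; exact: transferM.
  have DM : D (fun y => T1 i y * T i (\val s) y) by exact/D_T1M/Dv.
  have key (t u v z : R[i]) : t != 0 -> u * v = t * z -> z / t = u / t * (v / t).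
    by move=> ? uv; rewrite mulf_div uv -mulf_div divff// mul1r.
  have DM' : D (fun y => T i (\val a) y * T i (\val b) y) by rewrite TM.
  cbv beta; apply: (key _ _ _ _ t0).
  apply: etrans (esym (char_extM hd (Dv a) (Dv b) DM')) _.
  by rewrite TM; exact: (char_extM hd (D_T i (D_cst 1)) (Dv s) DM).
- rewrite E transfer_conj//; last by move=> x; rewrite conjc_real.
  have key (t u : R[i]) : t^* = t -> u^* / t = (u / t)^*.
    by move=> tt; rewrite rmorphM/= fmorphV/= tt.
  apply: etrans (key _ _ tr); congr (_ / _).
  exact: (char_ext_conj hd (Dv a)).
- by rewrite E divff.
Qed.

(** Evaluate [c] on the identity [mul_comp_transfer] and cancel one factor [c (w i)]. *)
Lemma char_ext_comp_transfer i (c : D -> R[i]) a : character c -> D a ->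
  char_ext c (w i) != 0 ->
  char_ext c (T i a \o phi) = char_ext c (w i) * char_ext c a.
Proof.
move=> hc Da wi0; apply: (mulfI wi0).
have DTa := D_comp (D_T i Da).
apply: etrans (esym (char_extM hc (D_w i) DTa (D_wM i DTa))) _.
transitivity (char_ext c (fun x => w i x * (w i x * a x))).
  by congr (char_ext c _); exact: mul_comp_transfer.
apply: etrans (char_extM hc (D_w i) (D_wM i Da) (D_wM i (D_wM i Da))) _.
by congr (_ * _); exact: (char_extM hc (D_w i) Da (D_wM i Da)).
Qed.

Lemma char_ext_transfer_comp i (d : D -> R[i]) a : character d -> D a ->
  char_ext d (T i (a \o phi)) = char_ext d (T1 i) * char_ext d a.
Proof.
move=> hd Da.
apply: etrans (char_extM hd (D_T i (D_cst 1)) Da (D_T1M i Da)).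
rewrite -(transfer_comp (@w_inj i)); congr (char_ext d (transfer phi _)).
by apply/funext => x /=; rewrite mul1r.
Qed.

(** After division by [d (T1 i)], the local inverse of [d] takes the value [d (T1 i)] at [w i],
    hence lands in the open set where [w i] does not vanish. *)
Lemma char_ext_transfer_weight i (d : D -> R[i]) : character d ->
  char_ext d (T i (w i)) = char_ext d (T1 i) * char_ext d (T1 i).
Proof.
have DT1 := D_T i (D_cst 1); move=> hd; rewrite transfer_self//.
exact: (char_extM hd DT1 DT1 (D_T1M i DT1)).
Qed.

Lemma char_ext_sum (c : D -> R[i]) (I : Type) (s : seq I) (F : I -> X -> R[i]) :
  character c -> (forall i, D_alg phi (F i)) ->
  char_ext c (fun x => \sum_(i <- s) F i x) = \sum_(i <- s) char_ext c (F i).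
Proof.
move=> hc DF; elim: s => [|i s IH].
  under eq_fun do rewrite big_nil.
  rewrite big_nil; have := @char_extZ _ _ _ _ hc 0 (fun=> 1) (D_cst 1).
  by under eq_fun do rewrite mul0r; rewrite mul0r; apply; exact: D_cst.
under eq_fun do rewrite big_cons; rewrite big_cons -IH.
by apply: (char_extD hc); apply: D_groupoid_alg => //; exact: D_alg_sum.
Qed.

(** The values [c (w i)] add up to [c 1 = 1]. *)
Lemma char_ext_weight_neq0 (c : D -> R[i]) : character c ->
  exists i, char_ext c (w i) != 0.
Proof.
move=> hc; apply: contrapT => ne.
have := char_ext1 hc (D_cst 1); have -> : (fun=> 1) = (fun x => \sum_i w i x).
  by apply/funext => x; rewrite sum_weight.
rewrite char_ext_sum//; last by move=> i; exact: D_alg_weight.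
rewrite big1 => [/esym/eqP|i _]; first by rewrite oner_eq0.
by apply/eqP/negPn/negP => ci; apply: ne; exists i.
Qed.

(* [S = \sum_i T1 i] takes its values in [1, .., n], so that
   [\prod_(k < n) (S - k.+1) = 0] and no character kills [S]. *)
Lemma char_ext_transfer_neq0 (d : D -> R[i]) : character d ->
  exists i, char_ext d (T1 i) != 0.
Proof.
move=> hd; apply: contrapT => ne; pose S y := \sum_i T1 i y.
have DS : D_alg phi S by exact: D_alg_sum.
have S0 : char_ext d S = 0.
  rewrite /S char_ext_sum// big1// => i _.
  by apply/eqP/negPn/negP => ci; apply: ne; exists i.
pose Q m y := \prod_(k < m) (S y - k.+1%:R).
have DSk k : D_alg phi (fun y => S y - k.+1%:R).
  by apply: D_algB => //; exact: D_alg_cst.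
have QS m : Q m.+1 = (fun y => Q m y * (S y - m.+1%:R)).
  by apply/funext => y; rewrite /Q big_ord_recr.
have Q0 : Q 0%N = (fun=> 1) by apply/funext => y; rewrite /Q big_ord0.
have DQ m : D_alg phi (Q m).
  by elim: m => [|m IH]; [rewrite Q0; exact: D_alg_cst|rewrite QS; exact: D_algM].
have chic (l : R[i]) : char_ext d (fun=> l) = l.
  have := @char_extZ _ _ _ _ hd l (fun=> 1) (D_cst 1).
  by under eq_fun do rewrite mulr1; rewrite char_ext1// mulr1; exact.
(* Since [d] is assumed to kill [S], no factor of the product is killed by [d]. *)
have chiS k : char_ext d (fun y => S y - k.+1%:R) = - k.+1%:R.
  rewrite (char_extD hd (D_groupoid_alg DS) (D_cst (- k.+1%:R))).
  by rewrite S0 add0r chic.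
have chiQ m : char_ext d (Q m) != 0.
  elim: m => [|m IH]; first by rewrite Q0 chic oner_eq0.
  rewrite QS (char_extM hd); [|exact: D_groupoid_alg..|]; last first.
    by apply: D_groupoid_alg; exact: D_algM.
  by rewrite chiS mulf_neq0// oppr_eq0 pnatr_eq0.
have := chiQ n; have -> : Q n = (fun=> 0); last by rewrite chic eqxx.
apply/funext => y.
(* The number of preimages of [y] is [m.+1] with [m < n], so the factor of index [m] vanishes at
   [y]. *)
have [[//|m] /= mn E] := transfer_count phi_surjective f_injective f_partition y.
by rewrite /Q (bigD1 (Ordinal mn))//= /S E subrr mul0r.
Qed.

Definition to_spectrum (c : D -> R[i]) (hc : character c) : spec :=
  exist _ (c : {ptws D -> R[i]^o}) (mem_set hc).

Definition dual_map (c : spec) : spec :=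
  to_spectrum (character_comp (set_mem (valP c))).

Lemma dual_mapE (c : spec) a : D a ->
  char_ext (\val (dual_map c)) a = char_ext (\val c) (a \o phi).
Proof. by move=> Da; rewrite char_extE. Qed.

Lemma spectrum_ext (c d : spec) :
  (forall a, D a -> char_ext (\val c) a = char_ext (\val d) a) -> c = d.
Proof.
move=> cd; apply/val_inj/funext => s.
by rewrite -[LHS]char_ext_val -[RHS]char_ext_val cd//; exact/set_mem/valP.
Qed.

Lemma is_dual_map_dual_map : is_dual_map dual_map.
Proof.
move=> c a; have Da : D (\val a \o phi) by exact/D_comp/set_mem/valP.
exists (exist _ (\val a \o phi) (mem_set Da)) => //.
exact: (char_extE (\val c) Da).
Qed.

Lemma continuous_char_ext a : D a ->
  continuous (fun c : spec => char_ext (\val c) a : R[i]^o).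
Proof.
move=> Da; rewrite (_ : (fun c : spec => _) =
  (fun c : spec => \val c (exist _ a (mem_set Da)))); first exact: continuous_eval.
by apply/funext => c; exact: char_extE.
Qed.

Lemma continuous_dual_map : continuous dual_map.
Proof.
apply: continuous_to_spectrum => a; apply: continuous_char_ext.
exact/D_comp/set_mem/valP.
Qed.

Lemma open_char_ext_neq0 a : D a ->
  open [set c : spec | char_ext (\val c) a != 0].
Proof.
move=> Da; have c0 : continuous (cst 0 : spec -> R[i]^o) by exact: cst_continuous.
have := open_neq_continuous (@norm_hausdorff _ R[i]^o) (continuous_char_ext Da) c0.
by congr open; apply/seteqP; split=> c /= /eqP.
Qed.

(** Total on the spectrum, with default value [d] outside the open set where [T1 i] is nonzero. *)
Definition local_inverse i (d : spec) : spec :=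
  if pselect (char_ext (\val d) (T1 i) != 0) is left d0
  then to_spectrum (character_transfer (set_mem (valP d)) d0) else d.

Lemma local_inverseE i (d : spec) a : D a -> char_ext (\val d) (T1 i) != 0 ->
  char_ext (\val (local_inverse i d)) a =
  char_ext (\val d) (T i a) / char_ext (\val d) (T1 i).
Proof.
by move=> Da d0; rewrite /local_inverse; case: pselect => // d0'; rewrite char_extE.
Qed.

(** The image of [c] sends [T i a] to [c (w i) * c a]. Taking [a = 1] shows that the denominator is
    [c (w i)], which cancels. *)
Lemma dual_mapK i (c : spec) : char_ext (\val c) (w i) != 0 ->
  char_ext (\val (dual_map c)) (T1 i) != 0 /\ local_inverse i (dual_map c) = c.
Proof.
have hc := set_mem (valP c) => wi.
have E a : D a -> char_ext (\val (dual_map c)) (T i a) =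
    char_ext (\val c) (w i) * char_ext (\val c) a.
  move=> Da; rewrite dual_mapE; last exact: D_T.
  exact: char_ext_comp_transfer.
have E1 : char_ext (\val (dual_map c)) (T1 i) = char_ext (\val c) (w i).
  by rewrite (E (fun=> 1)) ?(char_ext1 hc) ?mulr1.
have d0 : char_ext (\val (dual_map c)) (T1 i) != 0 by rewrite E1.
split; first exact: d0.
apply: spectrum_ext => a Da; rewrite (local_inverseE Da d0) (E a Da) E1.
exact: etrans (mulrC _ _) (mulKf wi _).
Qed.

(** At [a \o phi] the numerator is [d (T1 i) * d a] by [char_ext_transfer_comp], so the quotient is
    [d a]. *)
Lemma local_inverseK i (d : spec) : char_ext (\val d) (T1 i) != 0 ->
  char_ext (\val (local_inverse i d)) (w i) != 0 /\
  dual_map (local_inverse i d) = d.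
Proof.
have hd := set_mem (valP d) => d0; split.
  by rewrite (local_inverseE (D_w i) d0) (char_ext_transfer_weight i hd) (mulfK d0).
apply: spectrum_ext => a Da.
rewrite (dual_mapE _ Da) (local_inverseE (D_comp Da) d0).
rewrite (char_ext_transfer_comp i hd Da).
exact: etrans (mulrC _ _) (mulKf d0 _).
Qed.

Lemma dual_map_surjective (d : spec) : exists c, dual_map c = d.
Proof.
have [i d0] := char_ext_transfer_neq0 (set_mem (valP d)).
by exists (local_inverse i d); case: (local_inverseK d0).
Qed.

Lemma local_homeomorphism_dual_map : local_homeomorphism dual_map.
Proof.
move=> c; have [i ci] := char_ext_weight_neq0 (set_mem (valP c)).
pose B := [set d : spec | char_ext (\val d) (T1 i) != 0].
have imB : dual_map @` [set c : spec | char_ext (\val c) (w i) != 0] = B.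
  apply/seteqP; split=> [_ [e ei <-]|d /local_inverseK[di <-]].
    by have [] := dual_mapK ei.
  by exists (local_inverse i d).
have oB : open B by apply: open_char_ext_neq0; exact: D_T.
exists [set c : spec | char_ext (\val c) (w i) != 0]; rewrite imB; split.
- exact: open_char_ext_neq0.
- exact: ci.
- exact: oB.
- exact: continuous_subspaceT continuous_dual_map.
exists (local_inverse i); split; first by move=> e /set_mem/dual_mapK[].
apply: (@continuous_to_spectrum _ _ _ (subspace B)) => a.
have Da := set_mem (valP a).
(* On [B] each coordinate of the inverse is a quotient of two weak* continuous functions whose
   denominator does not vanish there. *)
apply: (@subspace_eq_continuous _ _ _
  (fun d : spec => char_ext (\val d) (T i (\val a)) / char_ext (\val d) (T1 i) : R[i]^o)).
  by move=> d /set_mem d0; rewrite -(local_inverseE Da d0) char_ext_val.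
apply: continuous_in_subspaceT => d /set_mem d0.
exact: (continuous_ratio (@continuous_char_ext _ (D_T i Da) d)
  (@continuous_char_ext _ (D_T i (D_cst 1)) d) d0).
Qed.

End dual_map.

Theorem proposition4p1 (R : realType) (X : topologicalType) (phi : X -> X)
    (X_nonempty : [set: X] !=set0)
    (X_compact : compact [set: X])
    (X_metrizable : metrizable R X)
    (phi_continuous : continuous phi)
    (phi_locally_injective : locally_injective phi)
    (phi_surjective : forall y : X, exists x : X, phi x = y) :
  exists psi : @spectrum R X phi -> @spectrum R X phi,
    [/\ is_dual_map psi,
        (forall d : @spectrum R X phi, exists c, psi c = d) &
        local_homeomorphism psi].
Proof.
have X_hausdorff := metrizable_hausdorff X_metrizable.
have [n [f [cf injf f1]]] := injective_partition X_nonempty X_compact X_metrizable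
  phi_locally_injective.
exists (dual_map X_compact X_hausdorff phi_continuous phi_locally_injective cf injf f1).
split.
- exact: is_dual_map_dual_map.
- exact: dual_map_surjective.
- exact: local_homeomorphism_dual_map.
Qed.
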